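(* Let $0<p<1$ be a fixed real number, and for each positive integer $n$ let $X_{n,p}$ be the number of cliques (maximal complete subgraphs) in the Erdős–Rényi random graph $G(n,p)$. Then $$\lim_{n\to\infty}\mathbb{P}\left[X_{n,p}<n^{\frac{\log n}{-2\log p}}\right]=1.$$
   Context: $G(n,p)$ is the random graph on $n$ labelled vertices in which each of the $\binom n2$ possible edges occurs independently with probability $p$. A clique of a graph means a maximal (with respect to inclusion) complete subgraph, i.e. a nonempty set of pairwise adjacent vertices not properly contained in another set of pairwise adjacent vertices. $\log$ denotes the natural logarithm. *)

(* Defs.v *)
From HB Require Import structures.
From mathcomp Require Import all_boot all_order all_algebra.
From mathcomp Require Import all_classical all_reals all_analysis.
Set Implicit Arguments.
Unset Strict Implicit.
Unset Printing Implicit Defensive.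
Import Order.TTheory GRing.Theory Num.Theory.
Local Open Scope ring_scope.

Notation vpair n := {e : {set 'I_n} | #|e| == 2%N}.

(* A simple graph on 'I_n is its set of edges. *)
Notation graph n := {set vpair n}.

Section Graph.
Variable n : nat.
Implicit Types (G : graph n) (S : {set 'I_n}).

Definition adj G : rel 'I_n :=
  fun u v => [exists e : vpair n, (e \in G) && (sval e == [set u; v]%SET)].

Definition complete G : pred {set 'I_n} :=
  fun S => [forall u in S, forall v in S, (u != v) ==> adj G u v].

Definition clique G : pred {set 'I_n} :=
  fun S => (S != finset.set0) && maxset (complete G) S.

Definition num_cliques G : nat := #|[pred S | clique G S]|.

End Graph.

Section Gnp.
Variables (R : realType) (n : nat) (p : R).

(* The edge indicators are independent Bernoulli(p) variables, so the law of
   G(n,p) is a product over all unordered pairs of distinct vertices. *)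
Definition Gnp_weight (G : graph n) : R :=
  \prod_(e : vpair n) (if e \in G then p else 1 - p).

Definition Gnp_prob (A : pred (graph n)) : R :=
  \sum_(G : graph n | A G) Gnp_weight G.

Lemma Gnp_prob_subset (E : {set vpair n}) :
  Gnp_prob (fun G : graph n => E \subset G) = p ^+ #|E|.
Proof.
pose g e := if e \in E then 0 else 1 - p.
transitivity (\prod_(e : vpair n) (p + g e)).
  rewrite bigA_distr /Gnp_prob big_mkcond /=; apply: eq_bigr => G _.
  case: ifPn => [/fintype.subsetP sEG|/subsetPn[e eE eG]].
    apply: eq_bigr => e _; case: ifPn => // eG.
    by rewrite /g ifN //; apply: contra eG; exact: sEG.
  by rewrite (bigD1 e) //= (negbTE eG) /g eE mul0r.
rewrite (bigID (mem E)) /= [X in _ * X]big1 => [|e /negbTE eE]; last first.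
  by rewrite /g eE addrC subrK.
rewrite mulr1 -prodr_const; apply: eq_bigr => e eE.
by rewrite /g eE addr0.
Qed.

Lemma Gnp_prob_total : Gnp_prob xpredT = 1.
Proof.
have := Gnp_prob_subset finset.set0; rewrite cards0 expr0 => <-.
by apply: eq_bigl => G; rewrite finset.sub0set.
Qed.

End Gnp.

(* Main.v *)
Require Import Defs.
From mathcomp Require Import all_boot all_order all_algebra.
From mathcomp Require Import all_classical all_reals all_analysis.
From mathcomp Require Import ring.
Import Order.TTheory GRing.Theory Num.Theory.
Import numFieldNormedType.Exports.
Local Open Scope classical_set_scope.
Local Open Scope ring_scope.

(** This is a first moment estimate.  A clique is in particular a complete set
    of vertices, so it suffices that the expected number of complete sets is of
    smaller order than the threshold.  Put [lam = - ln p], [l = ln n] and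
    [T = n `^ (l / (2 * lam)) = exp (l^2 / (2 * lam))].  A [k]-set is complete
    with probability [p ^+ 'C(k, 2) = exp (- lam * k * (k - 1) / 2)], and
    completing the square writes [n^k * p^'C(k, 2) / T] as
    [exp (- (lam / 2) * (k - l / lam)^2) * exp (lam / 2)^k].
    The parabola in the Gaussian exponent lies below its tangent at
    [k = l / lam - 1], which is [lam * k - l + lam / 2]; its constant term
    contains [- l], which gains a factor [1 / n]:
    [p^'C(k, 2) <= T * (C / n) * (c / n)^k], with [C = exp (lam / 2)] and
    [c = exp (3 * lam / 2)] depending on [p] only ([bin2_power_le]).

    The powers of [c / n], summed over all vertex sets, give
    [(1 + c / n)^n <= exp c] ([sum_subsets_exp_card]).  Counting [k]-sets rather
    than [k]-tuples matters here: with [n^k] in place of ['C(n, k)] the bound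
    would be the sum of the [c^k], which diverges as [c > 1].  The expected
    number of complete sets is therefore at most [T * C * exp c / n], and by
    Markov's inequality the event fails with probability at most
    [C * exp c / n] ([Gnp_prob_num_cliques_ge]). *)

Section FirstMoment.
Context {R : realType} {n : nat} {p : R}.
Hypotheses (p0 : 0 < p) (p1 : p < 1).

Lemma Gnp_weight_ge0 (G : graph n) : 0 <= Gnp_weight p G.
Proof.
by apply: prodr_ge0 => e _; case: ifP => _; [exact: ltW | rewrite subr_ge0 ltW].
Qed.

Lemma Gnp_prob_le (A B : pred (graph n)) :
  {subset A <= B} -> Gnp_prob p A <= Gnp_prob p B.
Proof.
move=> AB; rewrite /Gnp_prob big_mkcond [leRHS]big_mkcond /=.
apply: ler_sum => G _; case: ifPn => [AG|_].
  by rewrite ifT //; exact: AB.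
by case: ifP => // _; exact: Gnp_weight_ge0.
Qed.

Lemma Gnp_prob_predC (A : pred (graph n)) :
  Gnp_prob p A = 1 - Gnp_prob p (fun G => ~~ A G).
Proof.
by rewrite -(Gnp_prob_total n p) /Gnp_prob [in RHS](bigID A) /= addrK.
Qed.

Lemma Gnp_markov (X : graph n -> nat) (t : R) :
  t * Gnp_prob p (fun G => t <= (X G)%:R) <=
  \sum_(G : graph n) Gnp_weight p G * (X G)%:R.
Proof.
rewrite /Gnp_prob mulr_sumr [leLHS]big_mkcond /=; apply: ler_sum => G _.
case: ifP => [tX|_]; first by rewrite mulrC ler_wpM2l // Gnp_weight_ge0.
by rewrite mulr_ge0 // Gnp_weight_ge0.
Qed.

Definition inner_pairs (S : {set 'I_n}) : {set vpair n} :=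
  [set e : vpair n | sval e \subset S]%SET.

Lemma card_inner_pairs (S : {set 'I_n}) : #|inner_pairs S| = 'C(#|S|, 2).
Proof.
rewrite -cards_draws -(card_imset _ val_inj); apply: eq_card => A.
rewrite !inE; apply/imsetP/andP => [[e]|[AS A2]].
  by rewrite inE => eS ->; split=> //; exact: (svalP e).
by exists (Sub A A2) => //; rewrite inE.
Qed.

Lemma complete_inner_pairs (G : graph n) (S : {set 'I_n}) :
  complete G S -> inner_pairs S \subset G.
Proof.
move=> cS; apply/fintype.subsetP => e; rewrite inE => eS.
have /cards2P[u [v [uv euv]]] := svalP e.
have uS : u \in S by rewrite (fintype.subsetP eS) // euv !inE eqxx.
have vS : v \in S by rewrite (fintype.subsetP eS) // euv !inE eqxx orbT.
move/forall_inP: cS => /(_ u uS) /forall_inP /(_ v vS) /implyP /(_ uv).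
case/existsP=> f /andP[fG /eqP fuv].
by rewrite (_ : e = f) //; apply: val_inj; rewrite /= euv fuv.
Qed.

(** By linearity of expectation it is enough to bound the probability that a
    fixed [S] is a clique, and that event forces all ['C(#|S|, 2)] pairs inside
    [S] to be edges, which [Gnp_prob_subset] evaluates. *)
Lemma expected_num_cliques_le :
  \sum_(G : graph n) Gnp_weight p G * (num_cliques G)%:R <=
  \sum_(S : {set 'I_n}) p ^+ 'C(#|S|, 2).
Proof.
have cliqueE (G : graph n) :
    (num_cliques G)%:R = \sum_(S : {set 'I_n}) (clique G S)%:R :> R.
  rewrite /num_cliques -sum1_card natr_sum big_mkcond /=.
  by apply: eq_bigr => S _; rewrite inE; case: (clique G S).
under eq_bigr do rewrite cliqueE mulr_sumr.
rewrite exchange_big /=; apply: ler_sum => S _.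
rewrite -card_inner_pairs -Gnp_prob_subset.
apply: (@le_trans _ _ (Gnp_prob p (fun G => clique G S))).
  rewrite /Gnp_prob [leRHS]big_mkcond /=; apply: ler_sum => G _.
  by case: (clique G S); rewrite ?mulr1 ?mulr0.
apply: Gnp_prob_le => G /andP[_ /maxsetP[cS _]].
exact: complete_inner_pairs.
Qed.

End FirstMoment.

Lemma sum_subsets_exp_card (R : comNzRingType) (T : finType) (y : R) :
  \sum_(S : {set T}) y ^+ #|S| = (1 + y) ^+ #|T|.
Proof.
rewrite -prodr_const addrC bigA_distr /=; apply: eq_bigr => S _.
by rewrite -big_mkcond /= prodr_const.
Qed.

Lemma natr_bin2 (R : numFieldType) (k : nat) :
  'C(k, 2)%:R = k%:R * (k%:R - 1) / 2 :> R.
Proof.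
elim: k => [|k IH]; first by rewrite bin0n !mul0r.
by rewrite binS natrD IH bin1 -natr1; field.
Qed.

Section Threshold.
Context {R : realType} {p : R}.
Hypotheses (p0 : 0 < p) (p1 : p < 1).

Definition clique_threshold (n : nat) : R :=
  n%:R `^ (ln n%:R / (- 2 * ln p)).

(** The tangent line bound: both sides are exponentials, and the
    exponent of the right-hand side minus that of the left-hand side is
    [(- ln p / 2) * (k - x + 1)^2], where [x = ln n / - ln p]. *)
Lemma bin2_power_le (n k : nat) : (0 < n)%N ->
  p ^+ 'C(k, 2) <= clique_threshold n *
    (expR (- ln p / 2) / n%:R) * (expR (- (3 * ln p) / 2) / n%:R) ^+ k.
Proof.
move=> n0; have nR0 : 0 < n%:R :> R by rewrite ltr0n.
have lp : ln p < 0 by rewrite ln_lt0 // p0.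
rewrite /clique_threshold /powR gt_eqF //.
have pE : p = expR (ln p) by rewrite lnK.
rewrite [in leLHS]pE -{3 4}(lnK nR0).
rewrite -!expRN -!expRD -!expRM_natl -!expRD ler_expR natr_bin2.
set lnp := ln p in lp *; set l := ln n%:R; set K : R := k%:R.
have lnpN0 : lnp != 0 by rewrite lt_eqF.
rewrite -subr_ge0.
suff -> : l / (- 2 * lnp) * l + (- lnp / 2 - l) + K * (- (3 * lnp) / 2 - l)
    - K * (K - 1) / 2 * lnp = - lnp / 2 * (K + l / lnp + 1) ^+ 2.
  by rewrite mulr_ge0 ?sqr_ge0 // divr_ge0 // oppr_ge0 ltW.
by field.
Qed.

Lemma Gnp_prob_num_cliques_ge (n : nat) : (0 < n)%N ->
  Gnp_prob p (fun G : graph n => clique_threshold n <= (num_cliques G)%:R) <=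
  expR (- ln p / 2) * expR (expR (- (3 * ln p) / 2)) / n%:R.
Proof.
move=> n0; have nR0 : 0 < n%:R :> R by rewrite ltr0n.
have T0 : 0 < clique_threshold n by rewrite powR_gt0.
rewrite -(ler_pM2l T0).
apply: (le_trans (Gnp_markov p0 p1 (@num_cliques n) _)).
apply: (le_trans (expected_num_cliques_le p0 p1)).
apply: (@le_trans _ _ (\sum_(S : {set 'I_n}) (clique_threshold n *
    (expR (- ln p / 2) / n%:R) * (expR (- (3 * ln p) / 2) / n%:R) ^+ #|S|))).
  by apply: ler_sum => S _; exact: bin2_power_le.
rewrite -mulr_sumr sum_subsets_exp_card card_ord.
set c := expR (- (3 * ln p) / 2).
rewrite [in leRHS]mulrAC [leRHS]mulrA ler_wpM2l //.
  by rewrite mulr_ge0 ?ltW // divr_gt0 ?expR_gt0.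
have -> : expR c = expR (c / n%:R) ^+ n.
  by rewrite -expRM_natl mulrC divfK // gt_eqF.
by rewrite lerXn2r ?nnegrE ?expR_ge0 ?expR_ge1Dx //
  addr_ge0 // divr_ge0 ?expR_ge0.
Qed.

End Threshold.

Theorem corollary1 (R : realType) (p : R) (hp0 : 0 < p) (hp1 : p < 1) :
  (fun n : nat =>
     Gnp_prob p (fun G : graph n =>
       (num_cliques G)%:R < (n%:R : R) `^ (ln (n%:R : R) / (- 2 * ln p))))
    @ \oo --> (1 : R).
Proof.
(* The bounds hold for nonempty vertex sets only. *)
rewrite -(cvg_shiftn 1) /=.
pose C : R := expR (- ln p / 2) * expR (expR (- (3 * ln p) / 2)).
have cvgC : 1 - C * harmonic n @[n --> \oo] --> (1 : R).
  rewrite -[X in _ --> X]subr0; apply: cvgB; first exact: cvg_cst.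
  by rewrite -[X in _ --> X](mulr0 C); apply: cvgMr; exact: cvg_harmonic.
apply: squeeze_cvgr cvgC (cvg_cst (1 : R)).
apply: nearW => n; rewrite addn1 Gnp_prob_predC.
have -> : Gnp_prob p (fun G : graph n.+1 => ~~
    ((num_cliques G)%:R < n.+1%:R `^ (ln n.+1%:R / (- 2 * ln p)))) =
    Gnp_prob p (fun G : graph n.+1 =>
      clique_threshold (p := p) n.+1 <= (num_cliques G)%:R).
  by apply: eq_bigl => G; rewrite -leNgt.
rewrite lerD2l lerN2 Gnp_prob_num_cliques_ge //= lerBlDr lerDl.
by apply: sumr_ge0 => G _; exact: Gnp_weight_ge0.
Qed.
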